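(* Let $k$ be an algebraically closed field and let $n\ge 2$. For every integer $m\ge 0$ and every $A\in\mathfrak{gl}_n(k)$ the following seven identities of $n\times n$ matrices hold: \begin{align*} (1)\quad & (-1)^m\big((\partial_{ji}s_{m+1})(A)\big)_{ij}=A^m+\sum_{l=1}^m(-1)^l s_l(A)A^{m-l},\\ (2)\quad & \big((\partial_{ji}h_{m+1})(A)\big)_{ij}=A^m+\sum_{l=1}^m h_l(A)A^{m-l},\\ (3)\quad & \big((\partial_{ji}p_{m+1})(A)\big)_{ij}=(m+1)A^m,\\ (4)\quad & \big((\partial_{ji}s_{m+1})(A)\big)_{ij}=-A\,\big((\partial_{ji}s_m)(A)\big)_{ij}+s_m(A)I,\\ (5)\quad & \big((\partial_{ji}h_{m+1})(A)\big)_{ij}=A\,\big((\partial_{ji}h_m)(A)\big)_{ij}+h_m(A)I,\\ (6)\quad & (-1)^mA^m=\big((\partial_{ji}s_{m+1})(A)\big)_{ij}+\sum_{l=1}^m(-1)^l h_l(A)\big((\partial_{ji}s_{m+1-l})(A)\big)_{ij},\\ (7)\quad & A^m=\big((\partial_{ji}h_{m+1})(A)\big)_{ij}+\sum_{l=1}^m(-1)^l s_l(A)\big((\partial_{ji}h_{m+1-l})(A)\big)_{ij}. \end{align*}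
   Context: $\mathfrak{gl}_n=\mathfrak{gl}_n(k)$ is the space of $n\times n$ matrices over $k$, and $k[\mathfrak{gl}_n]$ is the polynomial algebra in the matrix entry functions $x_{ij}$, $1\le i,j\le n$. For an integer $m\ge 0$ the functions $s_m,h_m\in k[\mathfrak{gl}_n]$ are $s_m(A)=\mathrm{tr}(\wedge^m(A))$ and $h_m(A)=\mathrm{tr}(S^m(A))$, where $\wedge^m(A)$ and $S^m(A)$ are the $m$-th exterior and symmetric power of $A$; so $s_0=h_0=1$ and $s_m=0$ for $m>n$. For an integer $m\ge 1$, $p_m(A)=\mathrm{tr}(A^m)$. For $i,j\in\{1,\ldots,n\}$, $\partial_{ij}$ denotes partial differentiation with respect to $x_{ij}$. $(a_{ij})_{ij}$ denotes the $n\times n$ matrix with $(i,j)$ entry $a_{ij}$; in particular $\big((\partial_{ji}f)(A)\big)_{ij}$ is the matrix whose $(i,j)$ entry is $(\partial_{ji}f)(A)$ (note the transposed indices). $I$ is the identity matrix and $A^0=I$. *)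

(* Defs.v *)
From mathcomp Require Import all_boot all_order all_fingroup all_algebra.
From mathcomp Require Export mpoly.

Set Implicit Arguments.
Unset Strict Implicit.
Unset Printing Implicit Defensive.

Import GRing.Theory.
Local Open Scope ring_scope.

(* Matrices act on column vectors: A e_j = \sum_i A i j e_i. *)

(* The tuple i_1 < ... < i_m stands for the basis vector
   e_{i_1} /\ ... /\ e_{i_m} of the m-th exterior power of R^n. *)
Definition ext_basis (n m : nat) :=
  {t : m.-tuple 'I_n | sorted ltn (map val t)}.

(* The monomial a of degree m stands for the basis vector
   \prod_i e_i ^ (a i) of the m-th symmetric power of R^n. *)
Definition sym_basis (n m : nat) :=
  {a : 'X_{1..n < m.+1} | mdeg a == m}.

Section Powers.
Variables (R : comNzRingType) (n m : nat).

(* v_1 /\ ... /\ v_m in the basis ext_basis, where v_1, ..., v_m are the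
   columns of V. *)
Definition wedge (V : 'M[R]_(n, m)) : 'cV[R]_#|{: ext_basis n m}| :=
  \col_a \det (rowsub (tnth (val (enum_val a))) V).

(* The column of index J = (j_1 < ... < j_m) is A e_{j_1} /\ ... /\ A e_{j_m}. *)
Definition ext_power (A : 'M[R]_n) : 'M[R]_#|{: ext_basis n m}| :=
  \matrix_(a, b) wedge (colsub (tnth (val (enum_val b))) A) a 0.

(* The extension of A to the symmetric algebra R[e_1, ..., e_n] of R^n. *)
Definition sym_action (A : 'M[R]_n) (p : {mpoly R[n]}) : {mpoly R[n]} :=
  p \mPo [tuple \sum_i A i j *: 'X_i | j < n].

Definition sym_power (A : 'M[R]_n) : 'M[R]_#|{: sym_basis n m}| :=
  \matrix_(a, b) (sym_action A 'X_[bmnm (val (enum_val b))])@_(bmnm (val (enum_val a))).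

End Powers.

Arguments ext_power {R n} m A.
Arguments sym_power {R n} m A.

(* k[gl_n] is {mpoly k[n * n]}; the entry function x_ij is the variable of
   index mxvec_index i j. *)
Section MatrixFunctions.
Variables (k : comNzRingType) (n : nat).

Definition gl_eval (f : {mpoly k[n * n]}) (A : 'M[k]_n) : k :=
  f.@[fun v => mxvec A 0 v].

Definition genmx_gl : 'M[{mpoly k[n * n]}]_n :=
  \matrix_(i, j) 'X_(mxvec_index i j).

Definition s_gl (m : nat) : {mpoly k[n * n]} := \tr (ext_power m genmx_gl).
Definition h_gl (m : nat) : {mpoly k[n * n]} := \tr (sym_power m genmx_gl).
Definition p_gl (m : nat) : {mpoly k[n * n]} := \tr (genmx_gl ^+ m).

(* The (i, j) entry is the derivative with respect to x_ji. *)
Definition grad_gl (f : {mpoly k[n * n]}) (A : 'M[k]_n) : 'M[k]_n :=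
  \matrix_(i, j) gl_eval f^`M(mxvec_index j i) A.

End MatrixFunctions.

Section Facts.
Variables (k : comNzRingType) (n : nat).
Implicit Types (A : 'M[k]_n) (m : nat).

Lemma map_ext_power (R S : comNzRingType) (f : {rmorphism R -> S}) m
    (A : 'M[R]_n) : map_mx f (ext_power m A) = ext_power m (map_mx f A).
Proof.
apply/matrixP => a b; rewrite !mxE -det_map_mx; congr (\det _).
by apply/matrixP => i j; rewrite !mxE.
Qed.

Lemma map_sym_power (R S : comNzRingType) (f : {rmorphism R -> S}) m
    (A : 'M[R]_n) : map_mx f (sym_power m A) = sym_power m (map_mx f A).
Proof.
apply/matrixP => a b; rewrite !mxE -mcoeff_map_mpoly; congr (_@_ _).
rewrite /sym_action !comp_mpolyX rmorph_prod; apply: eq_bigr => j _.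
rewrite rmorphXn !tnth_mktuple raddf_sum; congr (_ ^+ _).
by apply: eq_bigr => i _; rewrite /= map_mpolyZ map_mpolyX mxE.
Qed.

Lemma eval_genmx_gl A :
  map_mx (meval (fun v => mxvec A 0 v)) (genmx_gl k n) = A.
Proof. by apply/matrixP => i j; rewrite !mxE mevalXU mxvecE. Qed.

Lemma gl_eval_s m A : gl_eval (s_gl k n m) A = \tr (ext_power m A).
Proof. by rewrite -[in RHS](eval_genmx_gl A) -map_ext_power trace_map_mx. Qed.

Lemma gl_eval_h m A : gl_eval (h_gl k n m) A = \tr (sym_power m A).
Proof. by rewrite -[in RHS](eval_genmx_gl A) -map_sym_power trace_map_mx. Qed.

Lemma gl_eval_p m A : gl_eval (p_gl k n m) A = \tr (A ^+ m).
Proof. by rewrite -[in RHS](eval_genmx_gl A) -rmorphXn trace_map_mx. Qed.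

Lemma Cauchy_Binet (m : nat) (M : 'M[k]_(m, n)) (N : 'M[k]_(n, m)) :
  \det (M *m N) = \sum_(I : ext_basis n m)
    \det (colsub (tnth (val I)) M) * \det (rowsub (tnth (val I)) N).
Proof.
have -> : \det (M *m N) = \sum_(f : {ffun 'I_m -> 'I_n})
    (\prod_i M i (f i)) * \det (rowsub f N).
  rewrite /determinant; under eq_bigr => s _.
    under eq_bigr => i _ do rewrite mxE.
    rewrite bigA_distr_bigA mulr_sumr /=; over.
  rewrite exchange_big; apply: eq_bigr => f _; rewrite mulr_sumr.
  apply: eq_bigr => s _; rewrite big_split mulrCA; congr (_ * (_ * _)).
  by apply: eq_bigr => i _; rewrite mxE.
rewrite (bigID (fun f : {ffun 'I_m -> 'I_n} => injectiveb f)) /= addrC big1 ?add0r.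
  2: move=> f /injectivePn [i [j ij fij]].
  2: rewrite (determinant_alternate ij) ?mulr0 // => l; by rewrite !mxE fij.
transitivity (\sum_(p : ext_basis n m * {perm 'I_m})
   (\prod_i M i (tnth (val p.1) (p.2 i)))
   * \det (rowsub (fun i => tnth (val p.1) (p.2 i)) N)).
  pose F (p : ext_basis n m * {perm 'I_m}) : {ffun 'I_m -> 'I_n} :=
    [ffun i => tnth (val p.1) (p.2 i)].
  have lt_I (I : ext_basis n m) (i j : 'I_m) :
      (i < j)%N -> (tnth (val I) i < tnth (val I) j)%N.
    move=> ij; have := valP I => /(sorted_ltn_nth ltn_trans 0%N).
    move=> /(_ i j); rewrite !inE size_map size_tuple !ltn_ord => /(_ isT isT ij).
    by rewrite !(nth_map (tnth (val I) i)) ?size_tuple // -!tnth_nth.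
  have inj_I (I : ext_basis n m) : injective (tnth (val I)).
    move=> i j e; apply/val_inj; case: (ltngtP i j) => // /lt_I;
      by move/(_ I); rewrite e ltnn.
  have injF : injective F.
    case=> I s [J t] /ffunP e.
    have eIJ : val I = val J.
      apply/val_inj/(inj_map val_inj)/(irr_sorted_eq ltn_trans ltnn).
      - exact: (valP I).
      - exact: (valP J).
      apply/eq_mem_map/subset_eqP/andP; split; apply/subsetP => x /tnthP [i ->].
        have := e ((s^-1)%g i); rewrite !ffunE /= permKV => ->; exact: mem_tnth.
      have := e ((t^-1)%g i); rewrite !ffunE /= permKV => <-; exact: mem_tnth.
    have {}eIJ : I = J by apply/val_inj.
    rewrite -eIJ in e *; congr (_, _); apply/permP => i.
    by have := e i; rewrite !ffunE /= => /inj_I.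
  have surjF (f : {ffun 'I_m -> 'I_n}) : injectiveb f -> exists p, F p = f.
    move=> /injectiveP injf; pose u := [tuple f i | i < m].
    pose t := sort_tuple (relpre val leq) u.
    have ot : sorted ltn (map val t).
      rewrite ltn_sorted_uniq_leq map_inj_uniq; last exact: val_inj.
      rewrite sort_uniq (map_inj_uniq injf) enum_uniq /= sorted_map.
      by apply: sort_sorted => x y; exact: leq_total.
    have /tuple_permP[s us] : perm_eq u t by rewrite perm_sym perm_sort.
    exists (Sub t ot, s); apply/ffunP => i; rewrite ffunE /=.
    have := congr1 (fun r => nth (f i) r i) us.
    by rewrite -!tnth_nth !tnth_mktuple => ->.
  rewrite (reindex_omap F (fun f => [pick p | F p == f])) /=; last first.
    move=> f /surjF[p <-]; case: pickP => [q /eqP <- //|/(_ p)].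
    by rewrite eqxx.
  apply: eq_big => [p|p _]; last first.
    congr (_ * _); first by apply: eq_bigr => i _; rewrite ffunE.
    by congr (\det _); apply/matrixP => i j; rewrite !mxE ffunE.
  apply/andP; split; last first.
    by case: pickP => [q /eqP/injF -> //|/(_ p)]; rewrite eqxx.
  by apply/injectiveP => i j; rewrite !ffunE => /inj_I/perm_inj.
rewrite -(pair_bigA _ (fun (I : ext_basis n m) (s : {perm 'I_m}) =>
   (\prod_i M i (tnth (val I) (s i)))
   * \det (rowsub (fun i => tnth (val I) (s i)) N))) /=.
apply: eq_bigr => I _; rewrite mulr_suml; apply: eq_bigr => s _.
have -> : rowsub (fun i => tnth (val I) (s i)) N =
    row_perm s (rowsub (tnth (val I)) N) by apply/matrixP => i j; rewrite !mxE.
rewrite row_permE det_mulmx det_perm mulrCA mulrA; congr (_ * _ * _).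
by apply: eq_bigr => i _; rewrite mxE.
Qed.

(* The matrix ext_power m A is that of the map v_1 /\ ... /\ v_m |->
   A v_1 /\ ... /\ A v_m. *)
Lemma ext_power_wedge m A (V : 'M[k]_(n, m)) :
  ext_power m A *m wedge V = wedge (A *m V).
Proof.
apply/matrixP => a c; rewrite !mxE.
have -> : rowsub (tnth (val (enum_val a))) (A *m V) =
    rowsub (tnth (val (enum_val a))) A *m V.
  by apply/matrixP => i j; rewrite !mxE; apply: eq_bigr => l _; rewrite mxE.
rewrite Cauchy_Binet (reindex (fun i : 'I_#|{: ext_basis n m}| => enum_val i)) /=;
  last exact/onW_bij/enum_val_bij.
apply: eq_bigr => b _; rewrite !mxE; congr (\det _ * _).
by apply/matrixP => i j; rewrite !mxE.
Qed.

End Facts.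

(* Main.v *)
Require Import Defs.
From mathcomp Require Import all_boot all_fingroup all_algebra.

Set Implicit Arguments.
Unset Strict Implicit.
Unset Printing Implicit Defensive.

Import GRing.Theory.
Local Open Scope ring_scope.

(** For a derivation [D] of a commutative ring and a matrix [X] over it, each of
    the three families satisfies [D (f X) = tr (D X * G)] for an explicit matrix
    [G]; taking for [D] the partial derivatives at the generic matrix, [G] is
    the gradient of [f]. For the power sums, cyclicity of the trace gives
    [G = (m + 1) X^m] at once. The rest of the proof rests on the recursions
    [grad s_(m+1) = - X grad s_m + s_m I] and
    [grad h_(m+1) = X grad h_m + h_m I] and on the identity
    [sum_l (-1)^l s_l h_(m-l) = 0] for [m > 0].

    Recursion for [s]: [s_m] is the coefficient of [t^m] in [det (1 + t X)]
    ([coef_det_1DZX]), so by Jacobi's formula ([leibniz_det]) its gradient is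
    the coefficient of [t^m] in [t adj (1 + t X)]. The recursion is the
    coefficient of [t^m] in [(1 + t X) adj (1 + t X) = det (1 + t X) I]
    ([ext_gradS]).

    Recursion for [h]: with [y_j = sum_i X_ij x_i], the trace [h_m] is the sum
    of the coefficients of [x^a] in [y^a] over the monomials [a] of degree [m].
    Entry [(l, i)] of the gradient of [h_(m+1)] is then the sum of the
    coefficients of [x^b] in [d/dx_l (x_i y^b)] over the monomials [b] of
    degree [m], and the two terms of the product rule are the two terms of the
    recursion ([sym_gradS]).

    Both recursions, up to signs, have the form [F_(m+1) = X F_m + c_m I] with
    [F_0 = 0] ([horner_rec]), that is [F(t) = t c(t) / (1 - t X)] for generating
    series. Unfolding expresses the gradients by powers of [X]. Multiplying [F]
    by a scalar series [b(t)] multiplies [c] by [b]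
    ([horner_rec_convolution]), and the expressions of the powers of [X] by the
    gradients are the cases in which [b c = 1].

    The identity [b c = 1] also follows from the recursions: with
    [S = sum (-1)^l s_l t^l] and [H = sum h_l t^l], the gradient of [S H] is
    [S grad H + H grad S]. The series [S grad H] and [- H grad S] both satisfy
    the recursion with [c = S H], so they agree and every partial derivative of
    [S H] vanishes. Over the integers this makes [S H] constant, and its value
    at the zero matrix is 1; specializing the coefficients gives the identity
    over every commutative ring. *)

(** * Principal minors and the determinant of 1 + tX *)

(** Sylvester's identity: the block matrix [[1, -U], [V, 1]] becomes triangular
    when multiplied by [[1, U], [0, 1]] on either side, with one of the two
    determinants in the remaining diagonal block. *)
Lemma det_1D_mulmxC (R : comNzRingType) m n (U : 'M[R]_(m, n))
    (V : 'M[R]_(n, m)) :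
  \det (1%:M + U *m V) = \det (1%:M + V *m U).
Proof.
have e1 : block_mx 1%:M (- U) V 1%:M *m block_mx 1%:M U 0 1%:M
   = block_mx 1%:M 0 V (1%:M + V *m U).
  by rewrite mulmx_block !(mulmx1, mul1mx, mulmx0, mul0mx, addr0, subrr) addrC.
have e2 : block_mx 1%:M U 0 1%:M *m block_mx 1%:M (- U) V 1%:M
   = block_mx (1%:M + U *m V) 0 V 1%:M.
  by rewrite mulmx_block !(mulmx1, mul1mx, mulmx0, mul0mx, add0r, addNr).
move/(congr1 determinant): e1; move/(congr1 determinant): e2.
by rewrite !det_mulmx !det_lblock !det_ublock !det1 !mul1r !mulr1 => <- ->.
Qed.

(** A principal minor as a determinant of full size, to match the terms in the
    expansion of [det (1 + t X)]. With [U] the 0-1 matrix of [f], the matrix on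
    the left is [1 + U (U^T (X - 1))], and Sylvester's identity moves [U] to the
    other side, leaving [1 + U^T (X - 1) U]. *)
Lemma det_principal_minor (R : comNzRingType) m n (f : 'I_m -> 'I_n)
    (X : 'M[R]_n) :
  injective f ->
  \det (\matrix_(i, j) (if i \in codom f then X i j else (i == j)%:R))
    = \det (mxsub f f X).
Proof.
move=> injf; pose U : 'M[R]_(n, m) := \matrix_(i, a) (i == f a)%:R.
have -> : (\matrix_(i, j) (if i \in codom f then X i j else (i == j)%:R))
    = 1%:M + U *m rowsub f (X - 1%:M).
  apply/matrixP => i j; rewrite !mxE.
  case: ifP => [/codomP [a ->]|ni]; last first.
    rewrite big1 ?addr0 // => a _; rewrite !mxE.
    case: eqP => [ia|]; last by rewrite mul0r.
    by rewrite ia codom_f in ni.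
  rewrite (bigD1 a) //= !mxE eqxx mul1r big1 ?addr0; first by
    rewrite addrC subrK.
  by move=> b nb; rewrite !mxE (inj_eq injf) eq_sym (negPf nb) mul0r.
rewrite det_1D_mulmxC; congr (\det _).
have -> : rowsub f (X - 1%:M) *m U = mxsub f f (X - 1%:M).
  apply/matrixP => a b; rewrite !mxE (bigD1 (f b)) //= !mxE eqxx mulr1.
  by rewrite big1 ?addr0 // => j nj; rewrite !mxE (negPf nj) mulr0.
apply/matrixP => a b; rewrite !mxE (inj_eq injf).
by rewrite addrC subrK.
Qed.

Lemma det_add_set (R : comNzRingType) n (B C : 'M[R]_n) :
  \det (B + C) = \sum_(J : {set 'I_n})
    \det (\matrix_(i, j) (if i \in J then C i j else B i j)).
Proof.
rewrite [RHS]exchange_big /=; apply: eq_bigr => s _; rewrite -mulr_sumr.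
congr (_ * _).
under eq_bigr do rewrite mxE addrC.
rewrite bigA_distr /=; apply: eq_bigr => J _.
by apply: eq_bigr => i _; rewrite mxE; case: ifP.
Qed.

Section ExteriorTrace.
Variables (R : comNzRingType) (n : nat).
Implicit Types X : 'M[R]_n.

(** Increasing tuples and subsets carry the same information; this and
    [ext_basis_of_set] are the two halves of the bijection. *)
Lemma ext_basis_sorted_enum m (t : ext_basis n m) :
  enum [set i in val t] = val t.
Proof.
apply: (inj_map val_inj); apply: (irr_sorted_eq ltn_trans ltnn).
- rewrite sorted_map /enum_mem; apply: sorted_filter.
    by move=> x y z; exact: ltn_trans.
  by rewrite -sorted_map -enumT val_enum_ord iota_ltn_sorted.
- exact: (valP t).
by apply: eq_mem_map => i; rewrite mem_enum inE.
Qed.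

Lemma ext_basis_inj m (t : ext_basis n m) : injective (tnth (val t)).
Proof.
move=> a b /eqP; set x0 := tnth (val t) a.
rewrite [x0](tnth_nth x0) (tnth_nth x0) nth_uniq ?size_tuple //;
  first by move/eqP/val_inj.
by rewrite -ext_basis_sorted_enum enum_uniq.
Qed.

Lemma ext_basis_of_set m (J : {set 'I_n}) (Jm : #|J| == m) :
  exists t : ext_basis n m, [set i in val t] = J.
Proof.
pose t := Tuple (introT eqP (etrans (esym (cardE J)) (eqP Jm))).
have ot : sorted ltn (map val t).
  rewrite sorted_map /= /enum_mem; apply: sorted_filter.
    by move=> x y z; exact: ltn_trans.
  by rewrite -sorted_map -enumT val_enum_ord iota_ltn_sorted.
by exists (exist _ t ot); apply/setP => i; rewrite inE /= mem_enum.
Qed.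

Lemma mxtrace_ext_power m X :
  \tr (ext_power m X) = \sum_(t : ext_basis n m)
    \det (mxsub (tnth (val t)) (tnth (val t)) X).
Proof.
rewrite (reindex (fun i : 'I_#|{: ext_basis n m}| => enum_val i)) /=;
  last exact/onW_bij/enum_val_bij.
apply: eq_bigr => a _; rewrite !mxE; congr (\det _).
by apply/matrixP => i j; rewrite !mxE.
Qed.

(** Expanding every row of [1 + t X] by additivity, the term of a set [J] of rows
    is [t ^ #|J|] times the principal minor of [X] on [J]. *)
Lemma coef_det_1DZX m X :
  (\det (1%:M + 'X *: map_mx polyC X))`_m = \tr (ext_power m X).
Proof.
pose M (J : {set 'I_n}) :=
  \matrix_(i, j) (if i \in J then X i j else (i == j)%:R : R).
have detJ (J : {set 'I_n}) : \det (\matrix_(i, j) (if i \in J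
    then ('X *: map_mx polyC X) i j else (1%:M : 'M[{poly R}]_n) i j))
    = (\det (M J))%:P * 'X^#|J|.
  rewrite -det_map_mx mulrC -prodr_const big_mkcond /=.
  pose d := \row_i (if i \in J then 'X else 1 : {poly R}).
  rewrite (_ : \prod_i _ = \det (diag_mx d)); last first.
    by rewrite det_diag; apply: eq_bigr => i _; rewrite !mxE.
  rewrite -det_mulmx mul_diag_mx; congr (\det _); apply/matrixP => i j.
  by rewrite !mxE; case: ifP => _; rewrite ?mul1r ?rmorph_nat.
rewrite det_add_set coef_sum mxtrace_ext_power.
pose h (t : ext_basis n m) := [set i in val t].
have inj_h : injective h.
  move=> t u /(congr1 (fun J : {set 'I_n} => enum J)).
  by rewrite !ext_basis_sorted_enum => tu; apply/val_inj/val_inj.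
under eq_bigr => J _ do rewrite detJ coefCM coefXn eq_sym mulr_natr mulrb.
rewrite -big_mkcond (reindex_omap h (fun J => [pick t | h t == J])) /=;
  last first.
  move=> J /ext_basis_of_set[t <-]; case: pickP => [u /eqP <- //|/(_ t)].
  by rewrite eqxx.
apply: eq_big => [t|t _].
  rewrite cardE ext_basis_sorted_enum size_tuple eqxx /=.
  by case: pickP => [u /eqP/inj_h -> //|/(_ t)]; rewrite eqxx.
rewrite -(det_principal_minor _ (@ext_basis_inj m t)); congr (\det _).
apply/matrixP => i j; rewrite !mxE inE; congr (if _ then _ else _).
by apply/tnthP/codomP => -[a ->]; exists a.
Qed.
End ExteriorTrace.

(** * Derivations *)

Definition leibniz (R : comNzRingType) (D : R -> R) :=
  forall x y, D (x * y) = D x * y + x * D y.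

Section Derivation.
Variables (R : comNzRingType) (D : {additive R -> R}).
Hypothesis DM : leibniz D.

Lemma leibniz1 : D 1 = 0.
Proof. by apply: (addrI (D 1)); rewrite addr0 -{3}[1]mulr1 DM mulr1 mul1r. Qed.

Lemma leibnizX x k : D (x ^+ k) = D x * x ^+ k.-1 *+ k.
Proof.
elim: k => [|k IH]; first by rewrite expr0 leibniz1 mulr0n.
rewrite exprS DM IH mulrS /=; congr (_ + _); rewrite mulrnAr mulrCA.
by case: k {IH} => [|k]; rewrite ?mulr0n // -exprS.
Qed.

Lemma leibniz_prod n (F : 'I_n -> R) :
  D (\prod_i F i) = \sum_i \prod_j (if j == i then D (F j) else F j).
Proof.
elim: n F => [|n IH] F; first by rewrite !big_ord0 leibniz1.
rewrite !big_ord_recl DM IH /=; congr (_ * _ + _).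
rewrite mulr_sumr; apply: eq_bigr => i _.
by rewrite big_ord_recl /=; congr (_ * _).
Qed.

(** Jacobi's formula: differentiating the Leibniz expansion differentiates one
    row at a time, and each resulting determinant is expanded along that row. *)
Lemma leibniz_det n (M : 'M[R]_n) : D (\det M) = \tr (map_mx D M *m \adj M).
Proof.
pose Mi i := \matrix_(a, b) (if a == i then D (M a b) else M a b).
transitivity (\sum_i \det (Mi i)).
  rewrite exchange_big raddf_sum; apply: eq_bigr => s _ /=.
  rewrite -mulr_sumr DM leibniz_prod.
  rewrite (_ : D (_ ^+ _) = 0) ?mul0r ?add0r; last first.
    by case: (odd_perm s); rewrite ?raddfN ?leibniz1 ?oppr0.
  congr (_ * _); apply: eq_bigr => i _; apply: eq_bigr => j _.
  by rewrite mxE.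
apply: eq_bigr => i _; rewrite (expand_det_row _ i) !mxE.
apply: eq_bigr => j _; rewrite !mxE eqxx; congr (_ * (_ * \det _)).
by apply/matrixP => a b; rewrite !mxE eq_sym (negPf (neq_lift _ _)).
Qed.

Lemma leibniz_monomial n (y : 'I_n -> R) (a : 'X_{1..n}) :
  D (\prod_j y j ^+ a j)
    = \sum_l (D (y l) * \prod_j y j ^+ (a - U_(l))%MM j) *+ a l.
Proof.
rewrite leibniz_prod; apply: eq_bigr => l _.
rewrite (bigD1 l) //= eqxx leibnizX [in RHS](bigD1 l) //=.
rewrite mnmBE mnm1E eqxx subn1 mulrA mulrnAl; congr (_ * _ *+ _).
apply: eq_bigr => j nj; rewrite (negPf nj) mnmBE mnm1E eq_sym (negPf nj).
by rewrite subn0.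
Qed.

Lemma leibniz_map_poly : leibniz (map_poly D).
Proof.
move=> p q; apply/polyP => k.
rewrite coefD coef_map !coefM raddf_sum -big_split.
by apply: eq_bigr => i _; rewrite /= DM !coef_map.
Qed.

Lemma leibniz_map_mpoly n :
  leibniz (map_mpoly D : {mpoly R[n]} -> {mpoly R[n]}).
Proof.
move=> p q; apply/mpolyP => k; rewrite mcoeffD mcoeff_map_mpoly !mcoeffM.
rewrite raddf_sum -big_split.
by apply: eq_bigr => i _; rewrite /= DM !mcoeff_map_mpoly.
Qed.

Lemma leibniz_mxM m n p (A : 'M[R]_(m, n)) (B : 'M[R]_(n, p)) :
  map_mx D (A *m B) = map_mx D A *m B + A *m map_mx D B.
Proof.
apply/matrixP => i j; rewrite !mxE raddf_sum -big_split.
by apply: eq_bigr => l _; rewrite !mxE DM.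
Qed.

(** The factor [X ^+ j] is what makes the induction on [m] go through: cyclicity
    of the trace moves the factor [X] of [X * D (X ^+ m)] into it. *)
Lemma leibniz_mxtrace_exp n (X : 'M[R]_n) m j :
  \tr (map_mx D (X ^+ m.+1) *m X ^+ j)
    = \tr (map_mx D X *m X ^+ (m + j)) *+ m.+1.
Proof.
elim: m j => [|m IH] j; first by rewrite expr1 add0n mulr1n.
rewrite exprS leibniz_mxM mulmxDl mxtraceD mulrS; congr (_ + _).
  by rewrite -mulmxA -[_ ^+ _ *m _]/(X ^+ m.+1 * X ^+ j) -exprD.
rewrite -mulmxA mxtrace_mulC -mulmxA -[X ^+ j *m X]/(X ^+ j * X) -exprSr.
by rewrite IH addnS.
Qed.
End Derivation.

(** * The gradient of the traces of exterior powers *)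

Section Ext.
Variables (R : comNzRingType) (n : nat).
Implicit Types X : 'M[R]_n.

(** The factor ['X] comes from [D (1 + t X) = t D X] in Jacobi's formula. *)
Definition ext_grad m X : 'M[R]_n :=
  \matrix_(i, j) ('X * \adj (1%:M + 'X *: map_mx polyC X) i j)`_m.

Lemma derivation_ext_power (D : {additive R -> R}) m X : leibniz D ->
  D (\tr (ext_power m X)) = \tr (map_mx D X *m ext_grad m X).
Proof.
move=> DM; rewrite -coef_det_1DZX -coef_map (leibniz_det (leibniz_map_poly DM)).
have -> : map_mx (map_poly D) (1%:M + 'X *: map_mx polyC X)
    = 'X *: map_mx polyC (map_mx D X).
  apply/matrixP => i j; rewrite !mxE raddfD raddfMn /=.
  rewrite (leibniz1 (leibniz_map_poly DM)) mul0rn add0r.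
  apply/polyP => k; rewrite coef_map !coefXM !coefC.
  by do 2?case: ifP; rewrite ?raddf0.
rewrite -scalemxAl scalemxAr coef_sum; apply: eq_bigr => i _.
rewrite !mxE coef_sum; apply: eq_bigr => j _.
by rewrite !mxE coefCM.
Qed.

(** This is the coefficient of [t^m] in
    [(1 + t X) adj (1 + t X) = det (1 + t X) I]. *)
Lemma ext_gradS m X :
  ext_grad m.+1 X = - (X *m ext_grad m X) + (\tr (ext_power m X))%:M.
Proof.
apply/matrixP => i j; rewrite -coef_det_1DZX.
have /matrixP/(_ i j) := mul_mx_adj (1%:M + 'X *: map_mx polyC X).
rewrite mulmxDl mul1mx -scalemxAl scalemxAr !mxE.
move=> /(congr1 (fun p : {poly R} => p`_m)).
rewrite coefD coefMn => <-; rewrite coefXM /= coef_sum.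
under [X in _ + (_ + X)]eq_bigr => l _ do rewrite !mxE coefCM.
under [X in - X + _]eq_bigr => l _ do rewrite !mxE.
by rewrite addrC addKr.
Qed.
End Ext.

(** * The gradient of the traces of symmetric powers *)

Section Sym.
Variables (R : comNzRingType) (n : nat).
Implicit Types X : 'M[R]_n.

(** The substitution [a = b + U_(l)]: monomials without the variable of index [l]
    contribute 0 to the left-hand side. *)
Lemma sym_basis_shift (V : nmodType) m (l : 'I_n) (F : 'X_{1..n} -> V) :
  \sum_(a : sym_basis n m.+1) F (val (val a)) *+ (val (val a)) l
  = \sum_(b : sym_basis n m) F (val (val b) + U_(l))%MM *+ ((val (val b)) l).+1.
Proof.
rewrite (bigID (fun a : sym_basis n m.+1 => 0 < (val (val a)) l)%N) /= addrC.
rewrite big1 ?add0r; last by move=> a; case: (val (val a) l).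
have degU (b : sym_basis n m) : mdeg (val (val b) + U_(l))%MM == m.+1.
  by rewrite mdegD mdeg1 (eqP (valP b)) addn1.
have ltU (b : sym_basis n m) : (mdeg (val (val b) + U_(l))%MM < m.+2)%N.
  by rewrite (eqP (degU b)).
pose h b : sym_basis n m.+1 := exist _ (BMultinom (ltU b)) (degU b).
have inj_h : injective h.
  by move=> b c /(congr1 (fun a => val (val a))) /= /addIm/val_inj/val_inj.
rewrite (reindex_omap h (fun a => [pick b | h b == a])) /=; last first.
  move=> a a_gt0; set a' := val (val a) in a_gt0.
  have leU : (U_(l) <= a')%MM by rewrite lep1mP -lt0n.
  have deg' : mdeg (a' - U_(l))%MM == m.
    rewrite -(eqn_add2r 1) -[X in (_ + X == _)%N](mdeg1 l) -mdegD submK //.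
    rewrite addn1.
    exact: (valP a).
  have lt' : (mdeg (a' - U_(l))%MM < m.+1)%N by rewrite (eqP deg').
  case: pickP => [b /eqP <- //|/(_ (exist _ (BMultinom lt') deg'))/eqP[]].
  by apply/val_inj/val_inj; rewrite /= submK.
apply: eq_big => [b|b _]; last by rewrite mnmDE mnm1E eqxx addn1.
rewrite mnmDE mnm1E eqxx addn1 /=.
by case: pickP => [u /eqP/inj_h -> //|/(_ b)]; rewrite eqxx.
Qed.

Definition sym_var X (j : 'I_n) : {mpoly R[n]} := \sum_i X i j *: 'X_i.

Lemma mxtrace_sym_power m X :
  \tr (sym_power m X) = \sum_(a : sym_basis n m)
    (\prod_j sym_var X j ^+ (val (val a)) j)@_(val (val a)).
Proof.
rewrite (reindex (fun i : 'I_#|{: sym_basis n m}| => enum_val i)) /=;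
  last exact/onW_bij/enum_val_bij.
apply: eq_bigr => a _; rewrite !mxE /sym_action comp_mpolyX; congr (_@_ _).
by apply: eq_bigr => j _; rewrite tnth_mktuple.
Qed.

(** Entry [(l, i)] collects the coefficients of [x^a] in
    [x_i * d(y^a)/dy_l], where [y = sym_var X]: by the chain rule this is what
    multiplies [D (X i l)] in the derivative of the trace. *)
Definition sym_grad m X : 'M[R]_n := \matrix_(l, i)
  \sum_(a : sym_basis n m)
    ('X_i * \prod_j sym_var X j ^+ (val (val a) - U_(l))%MM j)@_(val (val a))
      *+ (val (val a)) l.

Lemma derivation_sym_power (D : {additive R -> R}) m X : leibniz D ->
  D (\tr (sym_power m X)) = \tr (map_mx D X *m sym_grad m X).
Proof.
move=> DM; rewrite mxtrace_sym_power raddf_sum /=.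
under eq_bigr => a _ do
  rewrite -mcoeff_map_mpoly
    (leibniz_monomial (@leibniz_map_mpoly R D DM n)) raddf_sum.
rewrite exchange_big mxtrace_mulC /=; apply: eq_bigr => l _.
rewrite mxE.
have Dy : map_mpoly D (sym_var X l) = \sum_i D (X i l) *: 'X_i.
  rewrite raddf_sum; apply: eq_bigr => i _; apply/mpolyP => c.
  rewrite mcoeff_map_mpoly !mcoeffZ DM !mcoeffX -[RHS]addr0.
  by congr (_ + _); case: eqP; rewrite ?raddf0 ?leibniz1 ?mulr0.
under [RHS]eq_bigr => i _ do rewrite !mxE mulr_suml.
rewrite exchange_big; apply: eq_bigr => a _; rewrite Dy mulr_suml !raddfMn.
rewrite raddf_sum -sumrMnl; apply: eq_bigr => i _.
by rewrite /= -scalerAl mcoeffZ mulrnAl mulrC.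
Qed.

(** After the shift [a = b + U_(l)], the factor [(b l).+1] turns the coefficient of
    [x^(b + U_(l))] into the coefficient of [x^b] in the derivative along [x_l].
    The product rule for [x_i * y^b] then yields the scalar term from
    [d x_i / d x_l], and the matrix product from [d y_j / d x_l = X l j]. *)
Lemma sym_gradS m X :
  sym_grad m.+1 X = X *m sym_grad m X + (\tr (sym_power m X))%:M.
Proof.
apply/matrixP => l i; rewrite !mxE.
rewrite (@sym_basis_shift R m l (fun a =>
  ('X_i * \prod_j sym_var X j ^+ (a - U_(l))%MM j)@_a)).
have dX : ('X_i : {mpoly R[n]})^`M(l) = (l == i)%:R.
  rewrite mderivX mnm1E; case: eqVneq => [->|_]; last by rewrite scale0r.
  by rewrite scale1r -[X in (X - _)%MM]add0m addmK mpolyX0.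
under eq_bigr => b _ do rewrite addmK -mcoeff_deriv mderivM mcoeffD dX.
rewrite big_split addrC /=; congr (_ + _).
  rewrite mxtrace_sym_power -sumrMnl; apply: eq_bigr => b _.
  by rewrite mulr_natl mcoeffMn.
under [RHS]eq_bigr => j _ do rewrite !mxE mulr_sumr.
rewrite exchange_big /=; apply: eq_bigr => b _.
rewrite (leibniz_monomial (@mderivM n R l)) mulr_sumr raddf_sum.
apply: eq_bigr => j _ /=.
have -> : (sym_var X j)^`M(l) = (X l j)%:MP.
  rewrite raddf_sum (bigD1 l) //= big1 => [|p npl].
    rewrite mderivZ mderivX mnm1E eqxx scale1r -[X in (X - _)%MM]add0m addmK.
    by rewrite mpolyX0 alg_mpolyC addr0.
  by rewrite mderivZ mderivX mnm1E (negPf npl) scale0r scaler0.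
by rewrite mulrnAr mcoeffMn mulrCA mcoeffCM mulrnAr.
Qed.
End Sym.

(** * Horner recursions and convolution *)

Section Recursion.
Variables (R : comNzRingType) (n : nat) (X : 'M[R]_n).

(** In terms of generating series, [F(t) = t c(t) (1 - t X)^-1]. *)
Definition horner_rec (F : nat -> 'M[R]_n) (c : nat -> R) :=
  F 0%N = 0 /\ forall m, F m.+1 = X *m F m + (c m)%:M.

Definition convolution (b c : nat -> R) m :=
  \sum_(0 <= l < m.+1) b l * c (m - l)%N.

Lemma convolutionC b c m : convolution b c m = convolution c b m.
Proof.
rewrite /convolution big_nat_rev; apply: eq_big_nat => l /andP[_ lm].
by rewrite add0n subSS mulrC subKn.
Qed.

Lemma horner_recE F c m : horner_rec F c ->
  F m.+1 = \sum_(0 <= l < m.+1) c l *: X ^+ (m - l).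
Proof.
case=> F0 FS; elim: m => [|m IH].
  by rewrite FS F0 mulmx0 add0r big_nat1 expr0 scalemx1.
rewrite FS IH [RHS]big_nat_recr //= subnn expr0 scalemx1; congr (_ + _).
rewrite mulmx_sumr; apply: eq_big_nat => l /andP[_ lm].
by rewrite -scalemxAr subSn // exprS.
Qed.

(** Multiplying [F(t)] by the scalar series [b(t)] multiplies [c(t)] by it. *)
Lemma horner_rec_convolution F b c : horner_rec F c ->
  horner_rec (fun m => \sum_(0 <= l < m.+1) b l *: F (m - l)%N)
    (convolution b c).
Proof.
case=> F0 FS; split=> [|m]; first by rewrite big_nat1 F0 scaler0.
rewrite big_nat_recr //= subnn F0 scaler0 addr0 mulmx_sumr raddf_sum.
rewrite -big_split; apply: eq_big_nat => l /andP[_ lm].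
by rewrite subSn // FS scalerDr scalemxAr scale_scalar_mx.
Qed.

(** If [c(t) = 1], then [F(t)] is [t] times the geometric series of [X]. *)
Lemma horner_rec_delta F c m : horner_rec F c ->
  (forall l, c l = (l == 0%N)%:R) -> F m.+1 = X ^+ m.
Proof.
move=> /horner_recE -> c_delta; rewrite big_ltn // c_delta subn0 scale1r.
rewrite big_nat_cond big1 ?addr0 // => l /andP[/andP[l_gt0 _] _].
by rewrite c_delta gtn_eqF // scale0r.
Qed.

(** The new generating series are [- F(-t)] and [c(-t)]. *)
Lemma horner_rec_sign F c :
  F 0%N = 0 -> (forall m, F m.+1 = - (X *m F m) + (c m)%:M) ->
  horner_rec (fun m => - ((-1) ^+ m *: F m)) (fun m => (-1) ^+ m * c m).
Proof.
move=> F0 FS; split=> [|m]; first by rewrite F0 scaler0 oppr0.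
rewrite FS exprS mulN1r scaleNr opprK scalerDr scale_scalar_mx.
by rewrite mulmxN -scalemxAr scalerN.
Qed.
End Recursion.

(** * Constant polynomials and constant terms *)

Lemma mderiv_eq0_const (R : numDomainType) n (f : {mpoly R[n]}) :
  (forall i, f^`M(i) = 0) -> f = (f@_0%MM)%:MP.
Proof.
move=> df; apply/mpolyP => a; rewrite mcoeffC.
have [->|a0] := eqVneq a 0%MM; first by rewrite mulr1.
have /existsP[i ai] : [exists i, a i != 0%N].
  apply: contraR a0 => /existsPn ai; apply/eqP/mnmP => i.
  by rewrite mnm0E; apply/eqP; have := ai i; rewrite negbK.
rewrite mulr0; apply/eqP.
have := congr1 (mcoeff (a - U_(i))%MM) (df i).
rewrite mcoeff_deriv mcoeff0 submK ?lep1mP // => /eqP.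
by rewrite Num.Theory.mulrn_eq0.
Qed.

Lemma mxtrace_delta_mul (R : comNzRingType) n (Y : 'M[R]_n) i j :
  \tr (delta_mx j i *m Y) = Y i j.
Proof.
rewrite /mxtrace (bigD1 j) //= big1 => [|l lj]; rewrite mxE.
  rewrite (bigD1 i) //= mxE !eqxx mul1r big1 ?addr0 // => l li.
  by rewrite mxE eqxx (negPf li) mul0r.
by rewrite big1 // => p _; rewrite mxE (negPf lj) mul0r.
Qed.

Lemma mxtrace_ext_power0 (R : comNzRingType) n m :
  \tr (ext_power m (0 : 'M[R]_n)) = (m == 0%N)%:R.
Proof. by rewrite -coef_det_1DZX map_mx0 scaler0 addr0 det1 coef1. Qed.

Lemma mxtrace_ext_power_deg0 (R : comNzRingType) n (X : 'M[R]_n) :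
  \tr (ext_power 0 X) = 1.
Proof.
rewrite -coef_det_1DZX -horner_coef0 -horner_evalE -det_map_mx.
rewrite (_ : map_mx _ _ = 1%:M) ?det1 //; apply/matrixP => i j.
rewrite !mxE /= /horner_eval hornerD hornerM hornerX mul0r addr0.
by rewrite hornerMn hornerE.
Qed.

Lemma mxtrace_sym_power_deg0 (R : comNzRingType) n (X : 'M[R]_n) :
  \tr (sym_power 0 X) = 1.
Proof.
have d0 : (mdeg (0%MM : 'X_{1..n}) < 1)%N by rewrite mdeg0.
have e0 : mdeg (BMultinom d0) == 0%N by rewrite /= mdeg0.
pose a0 : sym_basis n 0 := exist _ (BMultinom d0) e0.
rewrite mxtrace_sym_power (big_pred1 a0) => [|a] /=.
  by rewrite big1 ?mcoeff1 ?eqxx // => j _; rewrite mnm0E expr0.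
apply/esym/eqP/val_inj/val_inj/eqP => /=.
by rewrite -mdeg_eq0; exact: (valP a).
Qed.

Lemma mxtrace_sym_power0 (R : comNzRingType) n m :
  \tr (sym_power m (0 : 'M[R]_n)) = (m == 0%N)%:R.
Proof.
case: m => [|m]; first exact: mxtrace_sym_power_deg0.
rewrite mxtrace_sym_power big1 // => a _.
have /existsP[j aj] : [exists j, (val (val a)) j != 0%N].
  apply: contraT => /existsPn a0.
  have := valP a; rewrite /= mdegE big1 // => j _.
  by apply/eqP; have := a0 j; rewrite negbK.
have y0 : sym_var (0 : 'M[R]_n) j = 0.
  by rewrite /sym_var big1 // => i _; rewrite mxE scale0r.
by rewrite (bigD1 j) //= y0 expr0n (negPf aj) mul0r mcoeff0.
Qed.

(** * Gradients at the generic matrix *)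

Section Gradient.
Variables (k : comNzRingType) (n : nat).
Local Notation X := (genmx_gl k n).

(** The polynomial matrix of which [grad_gl f A] is the value at [A]. *)
Definition grad_poly (f : {mpoly k[n * n]}) : 'M[{mpoly k[n * n]}]_n :=
  \matrix_(i, j) f^`M(mxvec_index j i).

Lemma mderiv_genmx_gl (i j : 'I_n) :
  map_mx (mderiv (mxvec_index j i)) X = delta_mx j i.
Proof.
apply/matrixP => p q; rewrite !mxE mderivX mnm1E.
have -> : (mxvec_index p q == mxvec_index j i) = (p == j) && (q == i).
  by rewrite (inj_eq (@cast_ord_inj _ _ _)) (inj_eq enum_rank_inj) xpair_eqE.
case: andP => [[/eqP-> /eqP->]|_]; last by rewrite scale0r.
by rewrite scale1r -[X in (X - _)%MM]add0m addmK mpolyX0.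
Qed.

(** A formula for all derivations determines the gradient, because
    differentiating the generic matrix with respect to [x_ji] gives the matrix
    unit [delta_mx j i], which picks out the entry [(i, j)] of [G]. *)
Lemma grad_poly_unique (f : {mpoly k[n * n]}) (G : 'M[{mpoly k[n * n]}]_n) :
  (forall D : {additive {mpoly k[n * n]} -> {mpoly k[n * n]}}, leibniz D ->
    D f = \tr (map_mx D X *m G)) -> grad_poly f = G.
Proof.
move=> Df; apply/matrixP => i j; rewrite mxE.
rewrite (Df (mderiv (mxvec_index j i))); last exact: mderivM.
by rewrite mderiv_genmx_gl mxtrace_delta_mul.
Qed.

Lemma grad_poly_s m : grad_poly (s_gl k n m) = ext_grad m X.
Proof. by apply: grad_poly_unique => D; exact: derivation_ext_power. Qed.

Lemma grad_poly_h m : grad_poly (h_gl k n m) = sym_grad m X.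
Proof. by apply: grad_poly_unique => D; exact: derivation_sym_power. Qed.

Lemma grad_poly_p m : grad_poly (p_gl k n m.+1) = m.+1%:R *: X ^+ m.
Proof.
apply: grad_poly_unique => D DM; have := leibniz_mxtrace_exp DM X m 0.
rewrite expr0 mulmx1 addn0 => trD.
have -> : D (p_gl k n m.+1) = \tr (map_mx D (X ^+ m.+1)).
  by rewrite raddf_sum; apply: eq_bigr => i _; rewrite mxE.
by rewrite trD -scalemxAr mxtraceZ mulr_natl.
Qed.

Lemma grad_poly_s0 : grad_poly (s_gl k n 0) = 0.
Proof. by rewrite grad_poly_s; apply/matrixP => i j; rewrite !mxE coefXM. Qed.

Lemma grad_poly_sS m :
  grad_poly (s_gl k n m.+1) = - (X *m grad_poly (s_gl k n m)) + (s_gl k n m)%:M.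
Proof. by rewrite !grad_poly_s ext_gradS. Qed.

Lemma grad_poly_s_rec :
  horner_rec X (fun m => - ((-1) ^+ m *: grad_poly (s_gl k n m)))
    (fun m => (-1) ^+ m * s_gl k n m).
Proof. exact: horner_rec_sign grad_poly_s0 grad_poly_sS. Qed.

Lemma grad_poly_h_rec :
  horner_rec X (fun m => grad_poly (h_gl k n m)) (h_gl k n).
Proof.
split=> [|m]; rewrite !grad_poly_h ?sym_gradS //.
apply/matrixP => i j; rewrite !mxE big1 // => a _.
have /eqP := valP a; rewrite /= => /eqP; rewrite mdeg_eq0 => /eqP ->.
by rewrite mnm0E mulr0n.
Qed.
End Gradient.

(** * The relation between the s_l and the h_l *)

(** The gradient of [sum_l (-1)^l s_l h_(m-l)] is the difference of two sequences
    that satisfy the same recursion: convolve the recursion of [grad h] with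
    [(-1)^l s_l], and the recursion of [- (-1)^l grad s_l] with [h]. *)
Lemma grad_poly_conv_s_h (k : comNzRingType) n m :
  grad_poly (convolution (fun l => (-1) ^+ l * s_gl k n l) (h_gl k n) m) = 0.
Proof.
have Rs := horner_rec_convolution (h_gl k n) (grad_poly_s_rec k n).
have Rh := horner_rec_convolution (fun l => (-1) ^+ l * s_gl k n l)
  (grad_poly_h_rec k n).
have eq_sh : \sum_(0 <= l < m.+1)
      ((-1) ^+ l * s_gl k n l) *: grad_poly (h_gl k n (m - l))
    = \sum_(0 <= l < m.+1)
        h_gl k n l *: - ((-1) ^+ (m - l) *: grad_poly (s_gl k n (m - l))).
  case: m => [|m]; first by case: Rs => -> _; case: Rh.
  rewrite (horner_recE m Rh) (horner_recE m Rs).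
  by apply: eq_bigr => l _; rewrite convolutionC.
transitivity (\sum_(0 <= l < m.+1)
    ((-1) ^+ l * s_gl k n l) *: grad_poly (h_gl k n (m - l))
  - \sum_(0 <= l < m.+1)
    h_gl k n l *: - ((-1) ^+ (m - l) *: grad_poly (s_gl k n (m - l))));
  last by rewrite eq_sh subrr.
rewrite [X in _ - X]big_nat_rev -sumrN -big_split /=; apply/matrixP => i j.
rewrite mxE raddf_sum summxE; apply: eq_big_nat => l /andP[_ lm].
rewrite /= add0n subSS subKn //.
move: (s_gl k n l) (h_gl k n (m - l)) => s h.
rewrite mderivM -signr_odd.
case: (odd l); rewrite /= ?expr1 ?expr0.
  by rewrite mulN1r mderivN scaleN1r opprK !mxE !mulNr addrC [h * _]mulrC.
by rewrite !mul1r scale1r scalerN opprK !mxE addrC [h * _]mulrC.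
Qed.

(** A polynomial over the integers whose partial derivatives vanish is constant.
    At the zero matrix all terms vanish when [m > 0]. *)
Lemma conv_s_h_int n m :
  convolution (fun l => (-1) ^+ l * s_gl int n l) (h_gl int n) m
    = (m == 0%N)%:R.
Proof.
set f := convolution _ _ _.
have df v : f^`M(v) = 0.
  case/mxvec_indexP: v => j i.
  by have /matrixP/(_ i j) := grad_poly_conv_s_h int n m; rewrite !mxE.
have -> : f = (gl_eval f 0)%:MP.
  by rewrite /gl_eval {2}(mderiv_eq0_const df) mevalC -mderiv_eq0_const.
have -> : gl_eval f 0 = \sum_(0 <= l < m.+1)
    (-1) ^+ l * gl_eval (s_gl int n l) 0 * gl_eval (h_gl int n (m - l)) 0.
  rewrite /gl_eval /f /convolution raddf_sum; apply: eq_bigr => l _.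
  by rewrite /= !mevalM rmorphXn /= mevalN meval1.
rewrite big_ltn // big_nat_cond big1 => [|l /andP[/andP[l_gt0 _] _]].
  rewrite gl_eval_s gl_eval_h mxtrace_ext_power0 mxtrace_sym_power0 subn0.
  by rewrite expr0 !mul1r addr0 mpolyC_nat.
by rewrite gl_eval_s mxtrace_ext_power0 gtn_eqF // mulr0 mul0r.
Qed.

Lemma map_genmx_gl (k : comNzRingType) n :
  map_mx (map_mpoly (intr : int -> k)) (genmx_gl int n) = genmx_gl k n.
Proof. by apply/matrixP => i j; rewrite !mxE map_mpolyX. Qed.

(** The traces are defined over the integers, so the identity specializes to
    every commutative ring, of any characteristic. *)
Lemma conv_s_h (k : comNzRingType) n m :
  convolution (fun l => (-1) ^+ l * s_gl k n l) (h_gl k n) m = (m == 0%N)%:R.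
Proof.
have := congr1 (map_mpoly (intr : int -> k)) (conv_s_h_int n m).
rewrite rmorph_nat => <-; rewrite raddf_sum; apply: eq_bigr => l _ /=.
rewrite !rmorphM rmorphXn rmorphN1 /=; congr (_ * _ * _).
  by rewrite -trace_map_mx map_ext_power map_genmx_gl.
by rewrite -trace_map_mx map_sym_power map_genmx_gl.
Qed.

(** * Gradients at a matrix *)

Section Evaluation.
Variables (k : comNzRingType) (n : nat) (A : 'M[k]_n).
Local Notation ev := (meval (fun v => mxvec A 0 v)).

Lemma grad_glE f : grad_gl f A = map_mx ev (grad_poly f).
Proof. by apply/matrixP => i j; rewrite !mxE. Qed.

Lemma grad_s0 : grad_gl (s_gl k n 0) A = 0.
Proof. by rewrite grad_glE grad_poly_s0 map_mx0. Qed.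

Lemma grad_sS m : grad_gl (s_gl k n m.+1) A
  = - (A *m grad_gl (s_gl k n m) A) + (gl_eval (s_gl k n m) A)%:M.
Proof.
rewrite !grad_glE grad_poly_sS map_mxD map_mxN map_mxM map_scalar_mx.
by rewrite eval_genmx_gl.
Qed.

Lemma grad_s_rec :
  horner_rec A (fun m => - ((-1) ^+ m *: grad_gl (s_gl k n m) A))
    (fun m => (-1) ^+ m * gl_eval (s_gl k n m) A).
Proof. exact: horner_rec_sign grad_s0 grad_sS. Qed.

Lemma grad_h_rec : horner_rec A (fun m => grad_gl (h_gl k n m) A)
  (fun m => gl_eval (h_gl k n m) A).
Proof.
have [dh0 dhS] := grad_poly_h_rec k n.
split=> [|m]; rewrite !grad_glE; first by rewrite dh0 map_mx0.
by rewrite dhS map_mxD map_mxM map_scalar_mx eval_genmx_gl.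
Qed.

Lemma grad_pS m : grad_gl (p_gl k n m.+1) A = m.+1%:R *: A ^+ m.
Proof.
rewrite grad_glE grad_poly_p map_mxZ rmorph_nat rmorphXn.
by rewrite /= eval_genmx_gl.
Qed.

Lemma gl_eval_conv_s_h m :
  convolution (fun l => (-1) ^+ l * gl_eval (s_gl k n l) A)
    (fun l => gl_eval (h_gl k n l) A) m = (m == 0%N)%:R.
Proof.
have := congr1 ev (conv_s_h k n m).
rewrite rmorph_nat => <-; rewrite raddf_sum; apply: eq_bigr => l _ /=.
by rewrite !mevalM rmorphXn /= mevalN meval1.
Qed.
End Evaluation.

Theorem theorem1 (k : closedFieldType) (n : nat) (hn : (2 <= n)%N)
    (m : nat) (A : 'M[k]_n) :
  let s l := gl_eval (s_gl k n l) A in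
  let h l := gl_eval (h_gl k n l) A in
  let ds l := grad_gl (s_gl k n l) A in
  let dh l := grad_gl (h_gl k n l) A in
  let dp l := grad_gl (p_gl k n l) A in
  [/\ (-1) ^+ m *: ds m.+1
        = A ^+ m + \sum_(1 <= l < m.+1) (-1) ^+ l *: (s l *: A ^+ (m - l)),
      dh m.+1 = A ^+ m + \sum_(1 <= l < m.+1) h l *: A ^+ (m - l),
      dp m.+1 = m.+1%:R *: A ^+ m
    & ds m.+1 = - (A *m ds m) + (s m)%:M]
  /\
  [/\ dh m.+1 = A *m dh m + (h m)%:M,
      (-1) ^+ m *: A ^+ m
        = ds m.+1 + \sum_(1 <= l < m.+1) (-1) ^+ l *: (h l *: ds (m.+1 - l)%N)
    & A ^+ m
        = dh m.+1 + \sum_(1 <= l < m.+1) (-1) ^+ l *: (s l *: dh (m.+1 - l)%N)].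
Proof.
move=> s h ds dh dp.
have Rs := grad_s_rec A; have Rh := grad_h_rec A.
have [/= dh0 dhS] := Rh.
have sh1 := gl_eval_conv_s_h A.
have s0 : gl_eval (s_gl k n 0) A = 1
  by rewrite gl_eval_s mxtrace_ext_power_deg0.
have h0 : gl_eval (h_gl k n 0) A = 1
  by rewrite gl_eval_h mxtrace_sym_power_deg0.
split; split=> //.
- have := horner_recE m Rs; rewrite exprS mulN1r scaleNr opprK => ->.
  rewrite [LHS]big_ltn // expr0 mul1r subn0 s0 scale1r.
  by under eq_bigr do rewrite -scalerA.
- by rewrite [LHS](horner_recE m Rh) [LHS]big_ltn // subn0 h0 scale1r.
- exact: grad_pS.
- exact: grad_sS.
- exact: dhS.
- have Rc := horner_rec_convolution h Rs.
  have sh1' l : convolution h (fun l => (-1) ^+ l * s l) l = (l == 0%N)%:R.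
    by rewrite convolutionC.
  (* The sum now runs over [0 <= l < m.+2]; its last term has the gradient of
     [s_0], which is zero. *)
  rewrite -(horner_rec_delta m Rc sh1').
  rewrite big_nat_recr //= subnn grad_s0 scaler0 oppr0 scaler0 addr0.
  transitivity (\sum_(0 <= l < m.+1) (-1) ^+ l *: (h l *: ds (m.+1 - l)%N)).
    rewrite scaler_sumr; apply: eq_big_nat => l /andP[_ lm].
    rewrite scalerA [in RHS]scalerA subSn // exprS mulN1r scaleNr opprK scalerA.
    rewrite mulrAC -exprD; congr (_ * _ *: _).
    by rewrite -[LHS]signr_odd oddD oddB // addbA addbb signr_odd.
  by rewrite [LHS]big_ltn // expr0 scale1r [h _]h0 scale1r subn0.
have Rc := horner_rec_convolution (fun l => (-1) ^+ l * s l) Rh.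
rewrite -(horner_rec_delta m Rc sh1).
rewrite big_nat_recr //= subnn dh0 scaler0 addr0 [LHS]big_ltn // expr0 mul1r.
by rewrite [s _]s0 scale1r subn0; under eq_bigr do rewrite -scalerA.
Qed.
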